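(* Let $d\ge 2$, $1\le m\le d-1$, and $\gcd(n,d+1)=1$. The dual dented pentagram map $\widehat T_m$ on twisted $n$-gons in $\mathbb{CP}^d$ is invariant with respect to (i.e. commutes with) the scaling transformations $$a_{k,1}\to s^{-1}a_{k,1},\quad a_{k,2}\to s^{-2}a_{k,2},\ \dots,\ a_{k,m}\to s^{-m}a_{k,m},$$ $$a_{k,m+1}\to s^{d-m}a_{k,m+1},\ \dots,\ a_{k,d}\to s\,a_{k,d}$$ (that is, $a_{k,j}\to s^{-j}a_{k,j}$ for $1\le j\le m$ and $a_{k,j}\to s^{d+1-j}a_{k,j}$ for $m+1\le j\le d$) for all $s\in\mathbb C^*$.
   Context: A twisted $n$-gon in $\mathbb{CP}^d$ with monodromy $M\in SL_{d+1}(\mathbb C)$ is a sequence $(v_k)_{k\in\mathbb Z}$ of points of $\mathbb{CP}^d$ with $v_{k+n}=Mv_k$ for all $k$; polygons are generic (no $d+1$ consecutive vertices in one hyperplane) and considered up to projective equivalence. The dual dented pentagram map (with a normalized index shift) is, generically, $$\widehat T_mv_k=(v_k,\dots,v_{k+m})\cap(v_{k+m+1},\dots,v_{k+d+1}),$$ the intersection of the projective subspaces (of dimensions $m$ and $d-m$) spanned by the listed vertices. Up to a shift of vertex indices it is the map $v_k\mapsto P_k\cap\dots\cap P_{k+d-m-1}\cap P_{k+d-m+1}\cap\dots\cap P_{k+d}$ with $P_k=(v_k,v_{k+1},\dots,v_{k+d-1})$. Coordinates: since $\gcd(n,d+1)=1$, the vertices lift to vectors $V_k\in\mathbb C^{d+1}$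 with $\det(V_j,\dots,V_{j+d})=1$ and $V_{j+n}=MV_j$ for all $j$; they satisfy $V_{k+d+1}=a_{k,d}V_{k+d}+\dots+a_{k,1}V_{k+1}+(-1)^dV_k$ with coefficients $n$-periodic in $k$. The $a_{k,j}$, $0\le k\le n-1$, $1\le j\le d$, are coordinates on the space of twisted $n$-gons. *)

(* Defs.v *)
From HB Require Import structures.
From mathcomp Require Import all_boot all_order all_algebra.
From mathcomp Require Import reals.
From mathcomp Require Import complex.

Set Implicit Arguments.
Unset Strict Implicit.
Unset Printing Implicit Defensive.

Import Order.TTheory GRing.Theory Num.Theory.
Local Open Scope ring_scope.

Section TwistedPolygons.
Variables (R : realType) (d : nat).

Local Notation C := R[i].

(* A projective subspace of CP^d is a linear subspace of C^(d+1); the points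
   of CP^d are the subspaces of dimension 1. *)
Local Notation subspace := {vspace 'cV[C]_d.+1}.

Record polygon := Polygon {
  vertex : int -> subspace;
  monodromy : 'M[C]_d.+1 }.

Definition mx_act (M : 'M[C]_d.+1) (U : subspace) : subspace :=
  (linfun (mulmx M) @: U)%VS.

Record twisted_ngon (n : nat) (P : polygon) : Prop := {
  monodromy_SL : \det (monodromy P) = 1;
  vertex_point : forall k : int, \dim (vertex P k) = 1%N;
  vertex_twisted : forall k : int,
    vertex P (k + n%:Z) = mx_act (monodromy P) (vertex P k);
  vertex_generic : forall k : int,
    ~ exists H : subspace,
        \dim H = d /\ forall i : 'I_d.+1, (vertex P (k + i%:Z) <= H)%VS }.

(* The map is total on sequences of subspaces; a twisted n-gon P lies in the
   domain of the map exactly when [dual_dented m P] is again a [twisted_ngon],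
   i.e. has point vertices in general position.  The monodromy is unchanged. *)
Definition dual_dented (m : nat) (P : polygon) : polygon :=
  Polygon
    (fun k => (\sum_(0 <= i < m.+1) vertex P (k + i%:Z)) :&:
              (\sum_(m.+1 <= i < d.+2) vertex P (k + i%:Z)))%VS
    (monodromy P).

Record normalized_lift (n : nat) (P : polygon) (V : int -> 'cV[C]_d.+1) :
    Prop := {
  lift_vertex : forall k : int, vertex P k = <[V k]>%VS;
  lift_det : forall k : int,
    \det (\matrix_(r < d.+1, i < d.+1) V (k + i%:Z) r 0) = 1;
  lift_twisted : forall k : int, V (k + n%:Z) = monodromy P *m V k }.

(* The entry [a k j] is the coordinate a_{k,j+1}.  Only 0 <= k < n is needed:
   the other instances of the recurrence follow by applying the monodromy. *)
Definition has_coordinates (n : nat) (P : polygon) (a : 'M[C]_(n, d)) : Prop :=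
  exists2 V : int -> 'cV[C]_d.+1, normalized_lift n P V &
    forall k : 'I_n,
      V (k%:Z + d.+1%:Z) =
        \sum_(j < d) a k j *: V (k%:Z + j.+1%:Z) + (-1) ^+ d *: V k%:Z.

(* For the coordinate index j+1 the exponent d+1-(j+1) is d-j. *)
Definition scale_coordinates (n m : nat) (s : C) (a : 'M[C]_(n, d)) :
    'M[C]_(n, d) :=
  \matrix_(k, j) ((if (j < m)%N then s ^- j.+1 else s ^+ (d - j)) * a k j).

(* The graph of the scaling transformation on the space of twisted n-gons:
   the coordinates determine a polygon up to projective equivalence. *)
Definition scaling (n m : nat) (s : C) (P P' : polygon) : Prop :=
  exists2 a : 'M[C]_(n, d),
    has_coordinates P a & has_coordinates P' (scale_coordinates m s a).

End TwistedPolygons.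

(* Main.v *)
Require Import Defs.
From HB Require Import structures.
From mathcomp Require Import all_boot all_order all_algebra.
From mathcomp Require Import reals.
From mathcomp Require Import complex.
From mathcomp Require Import zify.

Set Implicit Arguments.
Unset Strict Implicit.
Unset Printing Implicit Defensive.

Import Order.TTheory GRing.Theory Num.Theory.
Local Open Scope ring_scope.

(** Write a normalized lift V of a twisted polygon as a solution of
      a_{k,0} V_k + a_{k,1} V_{k+1} + ... + a_{k,d+1} V_{k+d+1} = 0,
    with a_{k,0} = (-1)^d and a_{k,d+1} = -1.  Cutting this relation after the
    index m gives one vector in two ways,
      W_k = sum_{j <= m} a_{k,j} V_{k+j} = - sum_{j > m} a_{k,j} V_{k+j},
    and W_k spans the vertex k of the image polygon ([line_capE]).

    The heart of the matter is to read off a linear relation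
    sum_{j <= d+1} b_j W_{k+j} = 0 from the coefficients a.  Expand W_{k+j} by
    its upper half (indices > m) when j <= m and by its lower half when j > m.
    Then only the d+1 independent vectors V_{k+m+1}, ..., V_{k+m+d+1} occur, so
    the relation amounts to the vanishing of d+1 explicit convolutions of b and
    a ([sum_dentedE]).  Every term of a convolution pairs an index <= m with an
    index > m.  The scaling multiplies a_{k,j} by s^(-j) or by s^(d+1-j), in
    these two cases respectively, so if b is scaled by the same rule, the
    convolution at the index e = i + j is multiplied by the single factor
    s^(d+1-e) ([conv_scaled]).  Hence b is a relation between the vectors W of
    the polygon if and only if the scaled b is a relation between those of the
    scaled polygon ([relation_scaled]).  This shows at once that both images are
    generic or neither is, and that the coordinates of the images are again
    related by the scaling.

    What remains is to normalize lifts.  The factors lam_k with prescribed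
    products over windows of d+1 consecutive indices exist because n and d+1 are
    coprime ([window_product_onto]).  For the image of the scaled polygon one
    reuses the factors found for the image of the first polygon; as the weights
    are 1 at the extreme indices 0 and d+1, the determinants of the resulting
    vectors do not depend on k, and a single (d+1)-st root normalizes them.
    Finally, any n-periodic coefficients are the coordinates of some polygon,
    obtained by solving the recurrence in both directions. *)

(** * Linear relations between consecutive vectors *)

Section Frames.
Variables (F : fieldType) (d : nat).
Implicit Types (V : int -> 'cV[F]_d.+1) (c : nat -> F) (k : int).

Definition frame V k : 'M[F]_d.+1 :=
  \matrix_(r < d.+1, i < d.+1) V (k + i%:Z) r 0.

Lemma frame_mulE V k (x : 'cV[F]_d.+1) :
  frame V k *m x = \sum_(i < d.+1) x i 0 *: V (k + i%:Z).
Proof.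
apply/colP => r; rewrite mxE summxE; apply: eq_bigr => i _.
by rewrite !mxE mulrC.
Qed.

Lemma frame_free V k c : \det (frame V k) != 0 ->
  \sum_(i < d.+1) c i *: V (k + i%:Z) = 0 -> forall i, (i < d.+1)%N -> c i = 0.
Proof.
rewrite -unitfE -unitmxE => uV c0 i lt_i.
have: frame V k *m (\col_(j < d.+1) c j) = 0.
  by rewrite frame_mulE -[RHS]c0; apply: eq_bigr => j _; rewrite mxE.
move/(canRL (mulKmx uV)); rewrite mulmx0 => /colP/(_ (Ordinal lt_i)).
by rewrite !mxE.
Qed.

(** Relations are indexed by natural numbers, here and below, so that the same
    coefficient function serves windows of length d+1 and d+2. *)
Lemma frame_det_neq0 V k :
  (forall c, \sum_(i < d.+1) c i *: V (k + i%:Z) = 0 ->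
     forall i, (i < d.+1)%N -> c i = 0) ->
  \det (frame V k) != 0.
Proof.
move=> freeV; rewrite -det_tr; apply/det0P => -[v nzv v0]; case/eqP: nzv.
apply/rowP => i; rewrite mxE.
have := freeV (fun j => v 0 (inord j)) _ i (ltn_ord i).
rewrite inord_val; apply.
under eq_bigr => j _ do rewrite inord_val.
apply/trmx_inj; rewrite trmx0 -[RHS]v0 -[v]trmxK -trmx_mul trmxK frame_mulE.
by congr (_^T); apply: eq_bigr => j _; rewrite mxE.
Qed.

(** All d+2 terms are on one side; with a_{k,d+1} = -1 this is the recurrence
    for V_{k+d+1}.  The symmetric form makes the cut at the index m and the
    scaling uniform in j. *)
Definition recurrence (a : int -> nat -> F) V :=
  forall k, \sum_(j < d.+2) a k j *: V (k + j%:Z) = 0.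

(** The vectors V_k, ..., V_{k+d+1} span a space of dimension d+1, so their
    relations form a line, generated by any relation normalized at d+1. *)
Lemma relation_unique V k (a c : nat -> F) : \det (frame V k) != 0 ->
  a d.+1 = -1 -> \sum_(j < d.+2) a j *: V (k + j%:Z) = 0 ->
  \sum_(j < d.+2) c j *: V (k + j%:Z) = 0 ->
  forall j, (j < d.+2)%N -> c j = - c d.+1 * a j.
Proof.
move=> nzV am1 a0 c0 j; rewrite ltnS leq_eqVlt => /predU1P[-> | lt_j].
  by rewrite am1 mulrN1 opprK.
(* Adding a multiple of the normalized relation removes the last term. *)
pose e i := c i + c d.+1 * a i.
suff /(frame_free nzV)/(_ j lt_j)/eqP : \sum_(i < d.+1) e i *: V (k + i%:Z) = 0.
  by rewrite addr_eq0 mulNr => /eqP.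
have: \sum_(i < d.+2) e i *: V (k + i%:Z) = 0.
  rewrite (eq_bigr (fun i : 'I_d.+2 =>
    c i *: V (k + i%:Z) + c d.+1 *: (a i *: V (k + i%:Z)))).
    by rewrite big_split -scaler_sumr /= a0 c0 scaler0 addr0.
  by move=> i _; rewrite scalerDl scalerA.
by rewrite big_ord_recr /= {2}/e am1 mulrN1 subrr scale0r addr0.
Qed.

Section Dented.
Variable m : nat.

(** The lower half of the recurrence: a lift of the image vertex. *)
Definition dented (a : int -> nat -> F) V k :=
  \sum_(j < d.+2 | (j <= m)%N) a k j *: V (k + j%:Z).

Lemma dentedN a V k : recurrence a V ->
  dented a V k = - \sum_(j < d.+2 | (m < j)%N) a k j *: V (k + j%:Z).
Proof.
move=> /(_ k); rewrite (bigID (fun j : 'I_d.+2 => (j <= m)%N)) /=.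
under [X in _ + X]eq_bigl => j do rewrite -ltnNge.
by move/eqP; rewrite addr_eq0 => /eqP.
Qed.

(** The coefficient of V_{k+m+1+e} in the expansion of a combination of the
    vectors [dented a V (k + j)], where exactly one of the two indices exceeds
    m.  The sign comes from the upper half of the recurrence, which is used for
    the indices j <= m. *)
Definition conv (b : nat -> F) (a : int -> nat -> F) k (e : nat) : F :=
  \sum_(p : 'I_d.+2 * 'I_d.+2 |
      ((m < p.1) (+) (m < p.2))%N && (p.1 + p.2 == m.+1 + e)%N)
    (-1) ^+ (p.1 <= m)%N * (b p.1 * a (k + p.1%:Z) p.2).

(** Choosing the half of the recurrence according to the position of j with
    respect to m keeps all indices i + j in a window of length d+1: both
    j <= m < i <= d+1 and i <= m < j <= d+1 give m < i + j <= m+d+1. *)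
Lemma sum_dentedE a V (b : nat -> F) k : recurrence a V ->
  \sum_(j < d.+2) b j *: dented a V (k + j%:Z) =
  \sum_(e < d.+1) conv b a k e *: V (k + m.+1%:Z + e%:Z).
Proof.
move=> recV.
transitivity (\sum_(p : 'I_d.+2 * 'I_d.+2 | ((m < p.1) (+) (m < p.2))%N)
    ((-1) ^+ (p.1 <= m)%N * (b p.1 * a (k + p.1%:Z) p.2)) *:
       V (k + (p.1 + p.2)%N%:Z)).
  rewrite -(pair_big_dep xpredT (fun i j : 'I_d.+2 => ((m < i) (+) (m < j))%N)
    (fun i j : 'I_d.+2 => ((-1) ^+ (i <= m)%N * (b i * a (k + i%:Z) j)) *:
       V (k + (i + j)%N%:Z))) /=.
  apply: eq_bigr => i _; case: (leqP i m) => le_im.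
    rewrite dentedN // scalerN -scaleN1r !scaler_sumr.
    by apply: eq_bigr => j _; rewrite !scalerA PoszD addrA expr1 mulrA.
  rewrite scaler_sumr; apply: eq_big => [j | j _]; first by rewrite /= -leqNgt.
  by rewrite !scalerA PoszD addrA mul1r.
rewrite (partition_big (fun p : 'I_d.+2 * 'I_d.+2 =>
   inord (p.1 + p.2 - m.+1) : 'I_d.+1) xpredT) //=.
apply: eq_bigr => e _; rewrite scaler_suml; apply: eq_big => [[i j] | [i j]] /=.
  case: (boolP (_ (+) _)) => //= mix.
  have [lo hi] : (m < i + j < m.+1 + d.+1)%N /\ (i + j - m.+1 < d.+1)%N.
    by have := ltn_ord i; have := ltn_ord j; move: mix; lia.
  by rewrite -(inj_eq val_inj) /= inordK //; lia.
case/andP=> mix /eqP eq_e; congr (_ *: V _).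
have hi : (m < i + j < m.+1 + d.+1)%N.
  by have := ltn_ord i; have := ltn_ord j; move: mix; lia.
rewrite -eq_e inordK; lia.
Qed.

Definition weight (s : F) (j : nat) : F :=
  if (j <= m)%N then s ^- j else s ^+ (d.+1 - j).

Definition scaled (s : F) (a a' : int -> nat -> F) :=
  forall k j, (j < d.+2)%N -> a' k j = weight s j * a k j.

Lemma scaled_sym s a a' : s != 0 -> scaled s a a' -> scaled s^-1 a' a.
Proof.
move=> nzs sa k j lt_j; rewrite sa // mulrA -[LHS]mul1r; congr (_ * _).
by rewrite /weight; case: ifP; rewrite ?exprVn ?mulVf ?mulfV ?invr_eq0 ?expf_neq0.
Qed.

(** A pair of indices i <= m < j has the total weight
    s^(-i) s^(d+1-j) = s^(d+1-(i+j)), which depends on i + j only. *)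
Lemma conv_scaled s (b : nat -> F) a a' k e : s != 0 -> scaled s a a' ->
  conv (fun j => weight s j * b j) a' k e =
  s ^+ d.+1 / s ^+ (m.+1 + e) * conv b a k e.
Proof.
move=> nzs sa; rewrite mulr_sumr; apply: eq_bigr => -[i j] /= /andP[mix /eqP <-].
rewrite [RHS]mulrCA; congr (_ * _); rewrite sa // mulrACA; congr (_ * _).
have lt_i := ltn_ord i; have lt_j := ltn_ord j.
move: mix; rewrite /weight !(leqNgt _ m) exprD invfM.
have [gt_i|le_i] := ltnP m i; have [gt_j|le_j] := ltnP m j => // _ /=;
  rewrite expfB_cond ?(negPf nzs) ?(ltnW lt_i) ?(ltnW lt_j) //.
  by rewrite mulrA.
by rewrite mulrCA.
Qed.

Lemma relation_scaled s a a' (b : nat -> F) V V' k : s != 0 ->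
  scaled s a a' -> (forall l, \det (frame V l) != 0) ->
  recurrence a V -> recurrence a' V' ->
  \sum_(j < d.+2) b j *: dented a V (k + j%:Z) = 0 ->
  \sum_(j < d.+2) (weight s j * b j) *: dented a' V' (k + j%:Z) = 0.
Proof.
move=> nzs sa nzV recV recV'; rewrite sum_dentedE // => /(frame_free (nzV _)) b0.
rewrite (sum_dentedE (fun j => weight s j * b j)) //.
by apply: big1 => e _; rewrite (conv_scaled _ _ _ nzs sa) b0 // mulr0 scale0r.
Qed.

(** A relation between d+1 consecutive vectors is a relation of length d+2
    whose last coefficient is zero, and the inverse scaling carries it back to
    the unscaled vectors. *)
Lemma dented_frame_neq0 s a a' V V' : s != 0 -> scaled s a a' ->
  (forall l, \det (frame V l) != 0) -> (forall l, \det (frame V' l) != 0) ->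
  recurrence a V -> recurrence a' V' ->
  (forall k, \det (frame (dented a V) k) != 0) ->
  forall k, \det (frame (dented a' V') k) != 0.
Proof.
move=> nzs sa nzV nzV' recV recV' nzW k.
apply: frame_det_neq0 => c c0 i lt_i.
pose b j := if (j < d.+1)%N then c j else 0.
have b0 : \sum_(j < d.+2) b j *: dented a' V' (k + j%:Z) = 0.
  rewrite big_ord_recr /= {2}/b ltnn scale0r addr0 -[RHS]c0.
  by apply: eq_bigr => j _; rewrite /b ltn_ord.
have nzsV : s^-1 != 0 by rewrite invr_eq0.
have := relation_scaled nzsV (scaled_sym nzs sa) nzV' recV' recV b0.
rewrite big_ord_recr /= {2}/b ltnn mulr0 scale0r addr0.
move/(frame_free (c := fun j => weight s^-1 j * b j) (nzW k))/(_ i lt_i)/eqP.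
by rewrite /b lt_i mulf_eq0 /weight; case: ifP => _;
  rewrite ?invr_eq0 expf_eq0 (negPf nzsV) andbF => /eqP.
Qed.

End Dented.
End Frames.

(** * Integer induction and two-sided linear recurrences *)

Lemma int_shift_ind (Q : int -> Prop) :
  Q 0 -> (forall k, Q k <-> Q (k + 1)) -> forall k, Q k.
Proof.
move=> Q0 QS; elim/int_ind=> // n Qn.
  by have /QS := Qn; congr Q; lia.
by apply/QS; congr Q: Qn; lia.
Qed.

Lemma int_period_ind (n : nat) (Q : int -> Prop) : (0 < n)%N ->
  (forall k, Q k <-> Q (k + n%:Z)) -> (forall k : 'I_n, Q k%:Z) ->
  forall k, Q k.
Proof.
move=> n_gt0 QS Q0 k; rewrite (divz_eq k n%:Z) addrC.
have nzn : n%:Z != 0 by lia.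
elim/int_shift_ind: (k %/ n%:Z)%Z => [|q].
  rewrite mul0r addr0; have := modz_ge0 k nzn; have := ltz_pmod k (d := n%:Z).
  case: (k %% n%:Z)%Z => // r; rewrite ltz_nat => /(_ n_gt0) lt_r _.
  exact: (Q0 (Ordinal lt_r)).
by rewrite mulrDl mul1r addrA.
Qed.

Section Solve.
Variables (F : fieldType) (d : nat).
Implicit Types (V : int -> 'cV[F]_d.+1) (a : int -> nat -> F) (k : int).

(** Column operations for one step of the recurrence: right multiplication by
    this matrix shifts a window of d+1 consecutive vectors by one. *)
Definition companion (c : nat -> F) : 'M[F]_d.+1 :=
  \matrix_(i, j) if j == ord_max then c i else (i == j.+1 :> nat)%:R.

Lemma det_companion c : \det (companion c) = (-1) ^+ d * c 0%N.
Proof.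
rewrite (expand_det_row _ ord0) (bigD1 ord_max) //= big1 => [|j nj]; last first.
  by rewrite !mxE (negPf nj) mul0r.
rewrite addr0 mxE eqxx /cofactor add0n mulrC; congr (_ * _).
rewrite [X in \det X](_ : _ = 1%:M) ?det1 ?mulr1 //.
apply/matrixP => i j; rewrite !mxE [lift _ j == _]eq_sym (negPf (neq_lift _ _)).
by rewrite lift0 lift_max eqSS.
Qed.

Lemma frame_succ V k (c : nat -> F) : c d.+1 = -1 ->
  \sum_(j < d.+2) c j *: V (k + j%:Z) = 0 ->
  frame V (k + 1) = frame V k *m companion c.
Proof.
move=> cN1 c0; apply/matrixP => r j; rewrite !mxE.
under eq_bigr => i _ do rewrite !mxE.
have [->|nj] := eqVneq j ord_max.
  move/colP/(_ r): c0; rewrite big_ord_recr /= cN1 scaleN1r !mxE summxE.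
  move/eqP; rewrite subr_eq0 => /eqP e; rewrite -addrA -PoszD add1n -e.
  by apply: eq_bigr => i _; rewrite !mxE mulrC.
have lt_j : (j.+1 < d.+1)%N.
  by rewrite ltnS ltn_neqAle nj -ltnS ltn_ord.
rewrite (bigD1 (Ordinal lt_j)) //= eqxx mulr1 big1 ?addr0 => [|i ni].
  by rewrite -addrA -PoszD add1n.
by rewrite (_ : (i == _ :> nat) = false) ?mulr0 //; apply: negPf.
Qed.

(** In a sequence of matrices that evolves by companion matrices, column j at
    time k is column 0 at time k + j; so such a sequence is the sequence of
    windows of its first columns. *)
Lemma frame_fromE (G : int -> 'M[F]_d.+1) a :
  (forall k, G (k + 1) = G k *m companion (a k)) ->
  forall k, frame (fun l => col 0 (G l)) k = G k.
Proof.
move=> GS k; apply/matrixP => r [j lt_j]; rewrite !mxE /=.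
elim: j lt_j k => [|j IH] lt_j k.
  by rewrite addr0; congr (G k r _); apply: val_inj.
rewrite (_ : k + j.+1%:Z = k + 1 + j%:Z); last by lia.
rewrite (IH (ltnW lt_j)) GS mxE (bigD1 (Ordinal lt_j)) //= mxE.
rewrite -(inj_eq val_inj) /= ltn_eqF // eqxx mulr1 big1 ?addr0 // => i ni.
rewrite mxE -(inj_eq val_inj) /= ltn_eqF //.
by rewrite (_ : (i == _ :> nat) = false) ?mulr0 //; apply: negPf.
Qed.

(** As a_{k,0} is nonzero, the companion matrices are invertible and the
    initial window can be propagated to negative times as well. *)
Lemma recurrence_solvable a : (forall k, a k 0%N != 0) ->
  (forall k, a k d.+1 = -1) ->
  exists2 V : int -> 'cV[F]_d.+1, recurrence a V & frame V 0 = 1%:M.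
Proof.
move=> nza am1.
have uC k : companion (a k) \is a GRing.unit.
  by rewrite unitmxE det_companion unitrM unitrX ?unitrN1 ?unitfE ?nza.
(* [Negz n] is the integer -(n+1). *)
pose G k : 'M[F]_d.+1 := match k with
  | Posz n => \prod_(0 <= i < n) companion (a i%:Z)
  | Negz n => \prod_(0 <= i < n.+1) (companion (a (Negz i)))^-1
  end.
have GS k : G (k + 1) = G k *m companion (a k).
  case: k => [n|[|n]].
  - by rewrite -PoszD addn1 /G big_nat_recr.
  - by rewrite /= big_nat1 big_geq // mulmxE mulVr.
  - rewrite (_ : Negz n.+1 + 1 = Negz n); last by lia.
    rewrite /G [in RHS]big_nat_recr //= mulmxE.
    by rewrite -[LHS]mulr1 -(mulVr (uC (Negz n.+1))) mulrA.
have [V frV] : exists V, forall k, frame V k = G k.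
  by exists (fun l => col 0 (G l)); apply: frame_fromE GS.
exists V; last by rewrite frV /= big_geq.
move=> k; have /colP e := congr1 (col ord_max) (GS k).
rewrite big_ord_recr /= am1 scaleN1r; apply/eqP; rewrite subr_eq0 eq_sym.
apply/eqP/colP => r; move: (e r); rewrite -!frV !mxE summxE.
rewrite -addrA -PoszD add1n => ->; apply: eq_bigr => i _.
by rewrite !mxE eqxx mulrC.
Qed.

Section Recurrence.
Variables (a : int -> nat -> F) (V : int -> 'cV[F]_d.+1).
Hypotheses (a0 : forall k, a k 0%N = (-1) ^+ d) (am1 : forall k, a k d.+1 = -1).
Hypothesis recV : recurrence a V.

(** A companion matrix with a_{k,0} = (-1)^d has determinant 1. *)
Lemma det_frame_const k : \det (frame V k) = \det (frame V 0).
Proof.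
elim/int_shift_ind: k => // k.
rewrite (frame_succ (am1 k) (recV k)) det_mulmx det_companion a0.
by rewrite -expr2 sqrr_sign mulr1.
Qed.

(** The windows at k and at k+n evolve by the same companion matrices, so they
    differ by a left factor that does not depend on k. *)
Lemma recurrence_monodromy (n : nat) :
  (forall k j, (j < d.+2)%N -> a (k + n%:Z) j = a k j) ->
  \det (frame V 0) != 0 ->
  exists2 M : 'M[F]_d.+1, \det M = 1 & forall k, V (k + n%:Z) = M *m V k.
Proof.
move=> per nzV.
have uV k : frame V k \in unitmx by rewrite unitmxE unitfE det_frame_const.
pose M := frame V n%:Z *m invmx (frame V 0).
exists M.
  by rewrite det_mulmx det_inv det_frame_const divff.
have MV k : frame V (k + n%:Z) = M *m frame V k.
  elim/int_shift_ind: k => [|k]; first by rewrite add0r mulmxKV.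
  have eC : companion (a (k + n%:Z)) = companion (a k).
    by apply/matrixP => i j; rewrite !mxE per // ltnS ltnW.
  rewrite addrAC !(frame_succ (am1 _) (recV _)) eC mulmxA.
  split=> [->//|]; apply: (can_inj (mulmxK _)).
  by rewrite unitmxE det_companion a0 -expr2 sqrr_sign unitr1.
move=> k; apply/colP => r; move/matrixP/(_ r 0): (MV k).
rewrite !mxE /= addr0 => ->; apply: eq_bigr => i _.
by rewrite [frame _ _ _ _]mxE addr0.
Qed.

End Recurrence.
End Solve.

(** * Periodic sequences with prescribed window products *)

Section Period.
Variables (K : numClosedFieldType) (n : nat) (E : int -> K).
Hypotheses (nzE : forall k, E k != 0) (perE : forall k, E (k + n%:Z) = E k).

(** Shifting the window by one replaces E(k) by E(k+n), which is equal to it. *)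
Lemma prod_period k :
  \prod_(0 <= i < n) E (k + i%:Z) = \prod_(0 <= i < n) E i%:Z.
Proof.
elim/int_shift_ind: k => [|k]; first by apply: eq_bigr => i _; rewrite add0r.
suff -> : \prod_(0 <= i < n) E (k + 1 + i%:Z) = \prod_(0 <= i < n) E (k + i%:Z).
  by [].
apply: (mulfI (nzE k)); transitivity (\prod_(0 <= i < n.+1) E (k + i%:Z)).
  rewrite big_nat_recl // addr0; congr (_ * _).
  by apply: eq_bigr => i _; rewrite -addrA -PoszD.
by rewrite big_nat_recr //= perE mulrC.
Qed.

Lemma prod_periods w k :
  \prod_(0 <= i < (w * n).+1) E (k + i%:Z) =
  (\prod_(0 <= i < n) E i%:Z) ^+ w * E k.
Proof.
elim: w k => [|w IH] k; first by rewrite mul0n big_nat1 addr0 mul1r.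
rewrite mulSn -addnS (big_cat_nat (n := n)) //=; last exact: leq_addr.
rewrite prod_period exprS -mulrA -(perE k) -IH.
rewrite -[X in index_iota X (n + _)]add0n (big_addn 0 _ n) addKn.
congr (_ * _); apply: eq_bigr => i _.
by rewrite addnC PoszD addrA.
Qed.

Lemma prod_blocks (f : nat -> K) u l :
  \prod_(j < l) \prod_(i < u) f (j + i * l)%N = \prod_(0 <= i < u * l) f i.
Proof.
rewrite exchange_big /=; elim: u => [|u IH].
  by rewrite mul0n big_ord0 big_geq.
rewrite big_ord_recr /= IH mulSn addnC [RHS](big_cat_nat (n := u * l)) //=;
  last exact: leq_addr.
congr (_ * _); rewrite -[X in index_iota X (_ + _)]add0n (big_addn 0 _ (u * l)).
by rewrite addKn big_mkord.
Qed.

(** Choose u l = w n + 1.  Let f(k) be the product of the u values E(k + i l).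
    A window product of f of length l is then a product of E over u l consecutive
    indices, that is, over w periods and one more index: it is T^w E(k), where T
    is the product of E over a period.  The constant factor T^w is
    then removed by an l-th root. *)
Lemma window_product_onto l : (0 < n)%N -> (0 < l)%N -> coprime n l ->
  exists lam : int -> K, [/\ forall k, lam k != 0,
    forall k, lam (k + n%:Z) = lam k &
    forall k, \prod_(j < l) lam (k + j%:Z) = E k].
Proof.
move=> n_gt0 l_gt0 co_nl; case: (egcdnP n l_gt0) => u w euw _.
rewrite gcdnC (eqP co_nl) addn1 in euw.
pose T := \prod_(0 <= i < n) E i%:Z; pose c := l.-root (T ^- w).
have nzT : T != 0 by rewrite prodf_seq_neq0; apply/allP => i _; apply: nzE.
have cl : c ^+ l = T ^- w by apply: rootCK.
have nzc : c != 0.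
  by have := expf_neq0 w nzT; rewrite -invr_eq0 -cl expf_eq0 l_gt0.
exists (fun k => c * \prod_(i < u) E (k + (i * l)%N%:Z)); split=> k.
- by rewrite mulf_neq0 //; apply/prodf_neq0 => i _.
- by congr (_ * _); apply: eq_bigr => i _; rewrite addrAC perE.
rewrite big_split /= prodr_const card_ord cl.
under eq_bigr => j _ do under eq_bigr => i _ do rewrite -addrA -PoszD.
rewrite (prod_blocks (fun i => E (k + i%:Z))) euw prod_periods mulrA mulVf ?mul1r //.
exact: expf_neq0.
Qed.

End Period.

(** * Spans of consecutive vectors *)

Section Subspaces.
Variables (F : fieldType) (d : nat).
Implicit Types (V : int -> 'cV[F]_d.+1) (a : int -> nat -> F) (k : int).

(** If the frame is singular, a nonzero row vector annihilates it, and the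
    kernel of that functional is a hyperplane through all the vertices. *)
Lemma generic_frame V k :
  (~ exists H : {vspace 'cV[F]_d.+1},
       \dim H = d /\ forall i : 'I_d.+1, (<[V (k + i%:Z)%R]> <= H)%VS) <->
  \det (frame V k) != 0.
Proof.
split=> [gen | nzV [H [dimH VH]]].
  apply/negP => /det0P[y nzy y0]; apply: gen.
  pose f := linfun (mulmx y) : 'Hom('cV[F]_d.+1, 'cV[F]_1).
  have fE x : f x = y *m x by rewrite lfunE.
  exists (lker f); split=> [|i]; last first.
    rewrite -memvE memv_ker fE; apply/eqP/matrixP => r c; rewrite !ord1.
    move/rowP/(_ i): y0; rewrite !mxE => y0i.
    by rewrite -[RHS]y0i; apply: eq_bigr => j _; rewrite !mxE.
  have: (0 < \dim (limg f) <= 1)%N.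
    apply/andP; split; last by apply: leq_trans (dimvS (subvf _)) _; rewrite dimvf.
    rewrite lt0n dimv_eq0; apply: contra nzy => /eqP f0; apply/eqP/rowP => i.
    have: f (delta_mx i 0) \in limg f by rewrite memv_img ?memvf.
    rewrite f0 memv0 fE -colE => /eqP/matrixP/(_ 0 0).
    by rewrite !mxE.
  have := limg_ker_dim f fullv; rewrite capfv dimvf dim_matrix.
  by rewrite [X in _ = X]muln1; move: (\dim _) (\dim _) => p q; lia.
have : \dim H = d.+1; last by rewrite dimH; lia.
suff -> : H = fullv by rewrite dimvf dim_matrix [LHS]muln1.
have uV : frame V k \in unitmx by rewrite unitmxE unitfE.
apply/vspaceP => x; rewrite memvf -(mulKVmx uV x) frame_mulE.
by apply: memv_suml => i _; apply: memvZ; rewrite memvE VH.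
Qed.

Lemma lines_sumP (N : nat) (Q : pred 'I_N) (v : 'I_N -> 'cV[F]_d.+1) x :
  x \in (\sum_(i < N | Q i) <[v i]>)%VS ->
  exists c : nat -> F, x = \sum_(i < N | Q i) c i *: v i.
Proof.
case/memv_sumP => vs vsP ->.
have /fin_all_exists[c cP] i : exists t, Q i -> vs i = t *: v i.
  by case: (boolP (Q i)) => [/vsP/vlineP[t ->] | _]; [exists t | exists 0].
exists (fun i => oapp c 0 (insub i)); apply: eq_bigr => i Qi.
by rewrite valK /= cP.
Qed.

(** A vector in both spans gives a relation between V_k, ..., V_{k+d+1}; by
    uniqueness of that relation the vector is a multiple of its lower half. *)
Lemma line_capE V k m (a : nat -> F) : (m <= d)%N ->
  \det (frame V k) != 0 -> a d.+1 = -1 ->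
  \sum_(j < d.+2) a j *: V (k + j%:Z) = 0 ->
  ((\sum_(0 <= i < m.+1) <[V (k + i%:Z)%R]>) :&:
   (\sum_(m.+1 <= i < d.+2) <[V (k + i%:Z)%R]>) =
   <[\sum_(j < d.+2 | (j <= m)%N) a j *: V (k + j%:Z)%R]>)%VS.
Proof.
move=> le_md nzV am1 a0.
pose L (i : nat) : {vspace 'cV[F]_d.+1} := <[V (k + i%:Z)%R]>%VS.
have -> : (\sum_(0 <= i < m.+1) L i = \sum_(i < d.+2 | (i <= m)%N) L i)%VS.
  by rewrite big_mkord (big_ord_widen d.+2) //; lia.
have -> : (\sum_(m.+1 <= i < d.+2) L i = \sum_(i < d.+2 | ~~ (i <= m)%N) L i)%VS.
  by rewrite big_geq_mkord; apply: eq_bigl => i; rewrite -ltnNge.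
have VL t (i : nat) : t *: V (k + i%:Z) \in L i by rewrite memvZ ?memv_line.
apply/eqP; rewrite eqEsubv; apply/andP; split; apply/subvP => x; last first.
  case/vlineP => t ->; apply: memvZ; apply/memv_capP; split.
    by apply: memv_sumr => i _; apply: VL.
  move/eqP: a0; rewrite (bigID (fun j : 'I_d.+2 => (j <= m)%N)) /= addr_eq0.
  by move/eqP->; rewrite memvN; apply: memv_sumr => i _; apply: VL.
case/memv_capP => /lines_sumP[b xb] /lines_sumP[c xc].
(* The relation obtained by subtracting the two expansions of x. *)
pose e j := if (j <= m)%N then b j else - c j.
have e0 : \sum_(j < d.+2) e j *: V (k + j%:Z) = 0.
  rewrite (bigID (fun j : 'I_d.+2 => (j <= m)%N)) /=.
  rewrite -[RHS](subrr x) {1}xb xc -sumrN; congr (_ + _); apply: eq_bigr => i.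
    by rewrite /e => ->.
  by rewrite /e => /negPf->; rewrite scaleNr.
apply/vlineP; exists (- e d.+1); rewrite xb scaler_sumr; apply: eq_bigr => i le_i.
by rewrite scalerA -(relation_unique nzV am1 a0 e0) // /e le_i.
Qed.

End Subspaces.

(** * Lifts and coordinates of twisted polygons *)

Section Lifts.
Variables (R : realType) (d : nat).
Local Notation C := R[i].
Implicit Types (P : polygon R d) (V W : int -> 'cV[C]_d.+1).
Implicit Types (a : int -> nat -> C) (n : nat).

Lemma mx_act_line (M : 'M[C]_d.+1) v : mx_act M <[v]>%VS = <[M *m v]>%VS.
Proof. by rewrite /mx_act limg_line lfunE. Qed.

Lemma mx_actM (M N : 'M[C]_d.+1) U : mx_act N (mx_act M U) = mx_act (N *m M) U.
Proof.
rewrite /mx_act -limg_comp; congr (_ @: U)%VS; apply/lfunP => x.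
by rewrite comp_lfunE !lfunE /= mulmxA.
Qed.

Lemma mx_act1 U : mx_act (1%:M : 'M[C]_d.+1) U = U.
Proof.
rewrite -[RHS]lim1g; congr (_ @: U)%VS; apply/lfunP => x.
by rewrite id_lfunE lfunE /= mul1mx.
Qed.

Lemma line_scale (t : C) (v : 'cV[C]_d.+1) : t != 0 -> <[t *: v]>%VS = <[v]>%VS.
Proof.
move=> nzt; apply/eqP; rewrite eqEsubv -!memvE memvZ ?memv_line //=.
by rewrite -[v in v \in _](scalerK nzt) memvZ ?memv_line.
Qed.

Lemma det_frame_rescale (lam : int -> C) V k :
  \det (frame (fun l => lam l *: V l) k) =
  \prod_(i < d.+1) lam (k + i%:Z) * \det (frame V k).
Proof.
transitivity (\det (frame V k *m diag_mx (\row_i lam (k + (i : 'I_d.+1)%:Z)))).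
  congr (\det _); apply/matrixP => r i.
  by rewrite mul_mx_diag !mxE mulrC.
rewrite det_mulmx det_diag mulrC; congr (_ * _).
by apply: eq_bigr => i _; rewrite mxE.
Qed.

(** A lift that is equivariant, but whose determinants need not be 1. *)
Record vector_lift n P V : Prop := {
  vector_vertex : forall k, vertex P k = <[V k]>%VS;
  vector_twisted : forall k, V (k + n%:Z) = monodromy P *m V k }.

Lemma twisted_ngonP n P V : \det (monodromy P) = 1 -> vector_lift n P V ->
  twisted_ngon n P <-> forall k, \det (frame V k) != 0.
Proof.
move=> detM [VP VM]; split=> [[_ _ _ gen] k | nzV].
  by apply/generic_frame => -[H [dimH HV]]; apply: (gen k); exists H; split=> // i;
     rewrite VP.
split=> // k.
- rewrite VP dim_vline; case: eqP => // V0; case/eqP: (nzV k).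
  apply: contraTeq isT => nzk.
  have := @frame_free _ _ V k (fun i => (i == 0%N)%:R) nzk _ 0%N isT.
  rewrite big_ord_recl /= addr0 V0 scaler0 big1 ?addr0 => [/(_ erefl)/eqP|i _].
    by rewrite oner_eq0.
  by rewrite scale0r.
- by rewrite !VP VM mx_act_line.
- case=> H [dimH HV]; move/generic_frame: (nzV k); apply; exists H; split=> // i.
  by rewrite -VP.
Qed.

(** Vectors are chosen for one period and transported by the powers of the
    monodromy. *)
Lemma vector_lift_exists n P : (0 < n)%N -> twisted_ngon n P ->
  exists V, vector_lift n P V.
Proof.
move=> n_gt0 [detM pt tw _]; set M := monodromy P in detM tw.
have uM : M \is a GRing.unit by rewrite unitmxE detM unitr1.
pose V k := M ^ (k %/ n%:Z)%Z *m vpick (vertex P (k %% n%:Z)%Z).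
have nzn : n%:Z != 0 by lia.
have VM k : V (k + n%:Z) = M *m V k.
  rewrite /V modzDr divzDr ?dvdzz // divzz nzn exprzDr // mulmxA; congr (_ *m _).
  by rewrite expr1z -commrXz.
exists V; split=> //; apply: (int_period_ind n_gt0) => [k | k].
  rewrite tw VM -mx_act_line; split=> [-> // | /(congr1 (mx_act (invmx M)))].
  by rewrite !mx_actM mulVmx // !mx_act1.
have in_k : 0 <= k%:Z < n%:Z by rewrite ltz_nat ltn_ord.
rewrite /V modz_small // divz_small // expr0z mul1mx.
apply/eqP; rewrite eq_sym eqEdim -memvE memv_pick pt dim_vline.
by rewrite vpick0 -dimv_eq0 pt.
Qed.

(** The determinants of the windows are n-periodic because the monodromy has
    determinant 1, so their inverses are products of periodic factors. *)
Lemma normalize_lift n P V : (0 < n)%N -> coprime n d.+1 ->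
  \det (monodromy P) = 1 -> vector_lift n P V ->
  (forall k, \det (frame V k) != 0) ->
  exists lam : int -> C, [/\ forall k, lam k != 0,
    forall k, lam (k + n%:Z) = lam k &
    normalized_lift n P (fun k => lam k *: V k)].
Proof.
move=> n_gt0 co_n detM [VP VM] nzV.
have perV k : \det (frame V (k + n%:Z)) = \det (frame V k).
  rewrite -[RHS]mul1r -detM -det_mulmx; congr (\det _); apply/matrixP => r i.
  rewrite !mxE addrAC VM mxE; apply: eq_bigr => j _.
  by rewrite mxE.
case: (@window_product_onto C n (fun k => (\det (frame V k))^-1) _ _ d.+1)
  => // [k | k | lam [nzl perl prodl]]; rewrite ?invr_eq0 ?perV //.
exists lam; split=> //; split=> k.
- by rewrite line_scale.
- by rewrite -/(frame _ _) det_frame_rescale prodl mulVf.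
- by rewrite perl VM scalemxAr.
Qed.

(** The extreme coefficients of a recurrence whose solutions have windows of
    constant determinant. *)
Definition normal_coeffs a :=
  forall k, a k 0%N = (-1) ^+ d /\ a k d.+1 = -1.

Lemma recurrence_coordinates (c : nat -> C) V k :
  c 0%N = (-1) ^+ d -> c d.+1 = -1 ->
  \sum_(j < d.+2) c j *: V (k + j%:Z) = 0 <->
  V (k + d.+1%:Z) =
    \sum_(j < d) c j.+1 *: V (k + j.+1%:Z) + (-1) ^+ d *: V k.
Proof.
move=> c0 cm1; rewrite big_ord_recr big_ord_recl /= c0 cm1 addr0 scaleN1r.
under eq_bigr => i _ do rewrite /bump add1n.
rewrite [X in X - _]addrC; split=> [/eqP | ->]; last by rewrite subrr.
by rewrite subr_eq0 => /eqP->.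
Qed.

Lemma lift_frame_neq0 n P V : normalized_lift n P V ->
  forall k, \det (frame V k) != 0.
Proof. by case=> _ detV _ k; rewrite /frame detV oner_neq0. Qed.

(** The coefficients are those of V_{k+d+1} in the basis V_k, ..., V_{k+d}.
    Comparing the determinants of two consecutive windows gives a_{k,0}, and
    periodicity follows by applying the monodromy to the relation. *)
Lemma lift_recurrence n P V : \det (monodromy P) = 1 -> normalized_lift n P V ->
  exists a, [/\ normal_coeffs a, forall k j, (j < d.+2)%N -> a (k + n%:Z) j = a k j &
    recurrence a V].
Proof.
move=> detM nV; have nzV := lift_frame_neq0 nV; case: (nV) => _ detV VM.
(* The default value -1 is the normalized last coefficient. *)
pose a k j := if (j < d.+1)%N then
  (invmx (frame V k) *m V (k + d.+1%:Z)) (inord j) 0 else -1.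
have recV : recurrence a V.
  move=> k; rewrite big_ord_recr /= {2}/a ltnn scaleN1r.
  rewrite -[V (k + d.+1%:Z)](mulKVmx (_ : frame V k \in unitmx)); last first.
    by rewrite unitmxE unitfE.
  rewrite frame_mulE; apply/eqP; rewrite subr_eq0; apply/eqP/eq_bigr => j _.
  by rewrite /a ltn_ord inord_val.
have am1 k : a k d.+1 = -1 by rewrite /a ltnn.
exists a; split=> // [k | k j lt_j].
  split=> //; have := congr1 determinant (frame_succ (am1 k) (recV k)).
  rewrite det_mulmx det_companion !detV mul1r => e.
  by rewrite -[LHS](signrMK d) -e mulr1.
suff e : \sum_(i < d.+2) a (k + n%:Z) i *: V (k + i%:Z) = 0.
  by rewrite (relation_unique (nzV k) (am1 k) (recV k) e) // am1 opprK mul1r.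
have uM : monodromy P \in unitmx by rewrite unitmxE detM unitr1.
apply: (can_inj (mulKmx uM)); rewrite mulmx0 -[RHS](recV (k + n%:Z)).
etransitivity; first exact: mulmx_sumr.
by apply: eq_bigr => i _; rewrite -scalemxAr -VM addrAC.
Qed.

Lemma has_coordinates_of n P V a : normalized_lift n P V -> normal_coeffs a ->
  recurrence a V -> has_coordinates P (\matrix_(k < n, j < d) a k%:Z j.+1).
Proof.
move=> nV na recV; exists V => // k; have [a0 am1] := na k%:Z.
have /(recurrence_coordinates _ _ a0 am1) -> := recV k.
by congr (_ + _); apply: eq_bigr => j _; rewrite mxE.
Qed.

(** The coordinates are given for one period only; uniqueness of the relation
    identifies them with the coefficients of a recurrence valid for all k. *)
Lemma coordinates_recurrence n P (A : 'M[C]_(n, d)) :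
  \det (monodromy P) = 1 -> has_coordinates P A ->
  exists V a, [/\ normalized_lift n P V, normal_coeffs a,
    forall k j, (j < d.+2)%N -> a (k + n%:Z) j = a k j,
    recurrence a V & forall (k : 'I_n) (j : 'I_d), a k%:Z j.+1 = A k j].
Proof.
move=> detM [V nV coV]; have [a [na pera recV]] := lift_recurrence detM nV.
exists V, a; split=> // k j; have [a0 am1] := na k%:Z.
(* The entry A k j is the coefficient with index j+1; beyond the range of A the
   default value -1 is the coefficient with index d+1. *)
pose c i := if i == 0%N then (-1) ^+ d else
  if insub i.-1 is Some i' then A k i' else -1.
have c0 : c 0%N = (-1) ^+ d by [].
have cm1 : c d.+1 = -1 by rewrite /c /= insubF ?ltnn.
have cS (i : 'I_d) : c i.+1 = A k i by rewrite /c /= valK.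
have recc : \sum_(i < d.+2) c i *: V (k%:Z + i%:Z) = 0.
  apply/recurrence_coordinates => //; rewrite coV; congr (_ + _).
  by apply: eq_bigr => i _; rewrite cS.
have nz := lift_frame_neq0 nV k%:Z.
rewrite (relation_unique nz cm1 recc (recV k%:Z)) ?am1 ?opprK ?mul1r ?cS //.
by rewrite !ltnS ltnW.
Qed.

End Lifts.

(** * The dual dented map and the scaling *)

Section DualDented.
Variables (R : realType) (d m n : nat).
Local Notation C := R[i].
Hypotheses (le_md : (m <= d)%N) (n_gt0 : (0 < n)%N) (co_n : coprime n d.+1).
Implicit Types (P : polygon R d) (V W : int -> 'cV[C]_d.+1).
Implicit Types (a : int -> nat -> C) (s : C).

(** The weights are 1 at both ends, so the scaling preserves the normalization
    of a recurrence. *)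
Lemma weight0 s : weight d m s 0 = 1.
Proof. by rewrite /weight leq0n expr0 invr1. Qed.

Lemma weight_last s : weight d m s d.+1 = 1.
Proof. by rewrite /weight leqNgt ltnS le_md subnn. Qed.

Lemma normal_scaled s a a' : scaled d m s a a' ->
  normal_coeffs d a -> normal_coeffs d a'.
Proof.
move=> sa na k; have [a0 am1] := na k.
by rewrite !sa // weight0 weight_last !mul1r.
Qed.

Lemma weightS s (j : nat) :
  weight d m s j.+1 = if (j < m)%N then s ^- j.+1 else s ^+ (d - j).
Proof. by rewrite /weight subSS. Qed.

Lemma scale_coordinatesE s a a' : scaled d m s a a' ->
  scale_coordinates m s (\matrix_(k < n, j < d) a k%:Z j.+1) =
  \matrix_(k < n, j < d) a' k%:Z j.+1.
Proof.
move=> sa; apply/matrixP => k j; rewrite !mxE sa ?weightS //.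
by rewrite !ltnS ltnW.
Qed.

Lemma dual_dented_lift P V a : normalized_lift n P V -> normal_coeffs d a ->
  (forall k j, (j < d.+2)%N -> a (k + n%:Z) j = a k j) -> recurrence a V ->
  vector_lift n (dual_dented m P) (dented m a V).
Proof.
move=> nV na pera recV; have nzV := lift_frame_neq0 nV.
case: nV => VP _ VM; split=> k.
  rewrite -(line_capE le_md (nzV k) (na k).2 (recV k)) /=.
  by congr (_ :&: _)%VS; apply: eq_bigr => i _; rewrite VP.
rewrite /dented /= mulmx_sumr; apply: eq_bigr => j _.
by rewrite pera // -scalemxAr -VM addrAC.
Qed.

Lemma scaling_exists s P : s != 0 -> twisted_ngon n P ->
  exists2 P' : polygon R d, twisted_ngon n P' & scaling n m s P P'.
Proof.
move=> nzs tP; have detM := monodromy_SL tP.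
have [W wl] := vector_lift_exists n_gt0 tP.
have nzW := (twisted_ngonP detM wl).1 tP.
have [lam [_ _ nV]] := normalize_lift n_gt0 co_n detM wl nzW.
have [a [na pera recV]] := lift_recurrence detM nV.
pose a' k j := weight d m s j * a k j.
have sa : scaled d m s a a' by [].
have na' := normal_scaled sa na.
have nza' k : a' k 0%N != 0 by rewrite (na' k).1 signr_eq0.
have [V' recV' V'0] := recurrence_solvable nza' (fun k => (na' k).2).
have a0' k := (na' k).1; have am1' k := (na' k).2.
have pera' k j : (j < d.+2)%N -> a' (k + n%:Z) j = a' k j.
  by move=> lt_j; rewrite /a' pera.
have nzV'0 : \det (frame V' 0) != 0 by rewrite V'0 det1 oner_neq0.
have [M detM' MV'] := recurrence_monodromy a0' am1' recV' pera' nzV'0.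
pose P' := Polygon (fun k => <[V' k]>%VS) M.
have detV' k : \det (frame V' k) = 1.
  by rewrite (det_frame_const a0' am1' recV') V'0 det1.
have nV' : normalized_lift n P' V' by split.
exists P'.
  apply/(twisted_ngonP (V := V')) => // k.
  by rewrite detV' oner_neq0.
exists (\matrix_(k < n, j < d) a k%:Z j.+1).
  exact: has_coordinates_of nV na recV.
by rewrite (scale_coordinatesE sa); apply: has_coordinates_of nV' na' recV'.
Qed.

(** Factors mu normalize the vectors W of the first image and give coefficients
    b.  Since (b_{k,j} mu_{k+j})_j is a relation between the vectors W, its
    scaling is one between the vectors W' of the second image; thus the vectors
    mu_k W'_k satisfy the recurrence with the scaled coefficients b'. *)
Lemma dual_dented_scaled s P P' : s != 0 ->
  twisted_ngon n P -> twisted_ngon n P' -> scaling n m s P P' ->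
  (twisted_ngon n (dual_dented m P) <-> twisted_ngon n (dual_dented m P')) /\
  (twisted_ngon n (dual_dented m P) ->
     scaling n m s (dual_dented m P) (dual_dented m P')).
Proof.
move=> nzs tP tP' [A coA coA'].
have detM := monodromy_SL tP; have detM' := monodromy_SL tP'.
have [V [a [nV na pera recV aA]]] := coordinates_recurrence detM coA.
have [V' [a' [nV' na' pera' recV' aA']]] := coordinates_recurrence detM' coA'.
have nzV := lift_frame_neq0 nV; have nzV' := lift_frame_neq0 nV'.
have sa : scaled d m s a a'.
  move=> k j lt_j; move: k; apply: (int_period_ind n_gt0) => [k | k].
    by rewrite pera // pera'.
  case: j lt_j => [|j] lt_j; first by rewrite weight0 mul1r (na _).1 (na' _).1.
  move: lt_j; rewrite ltnS ltnS leq_eqVlt => /predU1P[-> | lt_j].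
    by rewrite weight_last mul1r (na _).2 (na' _).2.
  by rewrite (aA' k (Ordinal lt_j)) (aA k (Ordinal lt_j)) mxE weightS.
have Wl := dual_dented_lift nV na pera recV.
have Wl' := dual_dented_lift nV' na' pera' recV'.
have tWP := twisted_ngonP (P := dual_dented m P) detM Wl.
have tWP' := twisted_ngonP (P := dual_dented m P') detM' Wl'.
have nzsV : s^-1 != 0 by rewrite invr_eq0.
split=> [|tD].
  rewrite tWP tWP'; split; first exact: (dented_frame_neq0 nzs sa).
  exact: (dented_frame_neq0 nzsV (scaled_sym nzs sa)).
have nzW := tWP.1 tD; have nzW' := dented_frame_neq0 nzs sa nzV nzV' recV recV' nzW.
have [mu [nzmu permu nX]] :=
  normalize_lift (P := dual_dented m P) n_gt0 co_n detM Wl nzW.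
have [b [nb perb recX]] := lift_recurrence (P := dual_dented m P) detM nX.
pose b' k j := weight d m s j * b k j.
have sb : scaled d m s b b' by [].
have nb' := normal_scaled sb nb.
pose Y k := mu k *: dented m a' V' k.
have recY : recurrence b' Y.
  move=> k.
  have e0 : \sum_(j < d.+2) (b k j * mu (k + j%:Z)) *: dented m a V (k + j%:Z) = 0.
    by rewrite -[RHS](recX k); apply: eq_bigr => j _; rewrite scalerA.
  have e := relation_scaled (b := fun j => b k j * mu (k + j%:Z))
    nzs sa nzV recV recV' e0.
  by rewrite -[RHS]e; apply: eq_bigr => j _; rewrite /Y scalerA mulrA.
have nzY : \det (frame Y 0) != 0.
  by rewrite det_frame_rescale mulf_neq0 //; apply/prodf_neq0.
pose c := d.+1.-root (\det (frame Y 0))^-1.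
have cd : c ^+ d.+1 = (\det (frame Y 0))^-1 by apply: rootCK.
have nzc : c != 0.
  by have := nzY; rewrite -invr_eq0 -cd expf_eq0.
have nX' : normalized_lift n (dual_dented m P') (fun k => c *: Y k).
  case: Wl' => WP' WM'; split=> k.
  - by rewrite WP' /Y !line_scale.
  - rewrite -/(frame _ _) (det_frame_rescale (fun=> c)) prodr_const card_ord cd.
    rewrite (det_frame_const _ _ recY) ?mulVf // => l; first exact: (nb' l).1.
    exact: (nb' l).2.
  - by rewrite /Y WM' permu !scalemxAr.
have recX' : recurrence b' (fun k => c *: Y k).
  move=> k; rewrite -[RHS](scaler0 _ c) -[X in _ = c *: X](recY k) scaler_sumr.
  by apply: eq_bigr => j _; rewrite [LHS]scalerA mulrC -[LHS]scalerA.
exists (\matrix_(k < n, j < d) b k%:Z j.+1).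
  exact: has_coordinates_of nX nb recX.
by rewrite (scale_coordinatesE sb); apply: has_coordinates_of nX' nb' recX'.
Qed.

End DualDented.

Theorem theorem3p4 (R : realType) (n d m : nat)
    (hd : (2 <= d)%N) (hm1 : (1 <= m)%N) (hmd : (m <= d - 1)%N)
    (hnd : gcdn n d.+1 = 1%N) (s : R[i]) (hs : s != 0)
    (P : polygon R d) (hP : twisted_ngon n P) :
  (exists2 P' : polygon R d, twisted_ngon n P' & scaling n m s P P') /\
  (forall P' : polygon R d, twisted_ngon n P' -> scaling n m s P P' ->
     (twisted_ngon n (dual_dented m P) <-> twisted_ngon n (dual_dented m P')) /\
     (twisted_ngon n (dual_dented m P) ->
        scaling n m s (dual_dented m P) (dual_dented m P'))).
Proof.
have le_md : (m <= d)%N by lia.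
have co_n : coprime n d.+1 by apply/eqP.
have n_gt0 : (0 < n)%N by case: n hnd {hP co_n} => // ; rewrite gcd0n; lia.
split; first exact: scaling_exists.
by move=> P' hP' PP'; apply: dual_dented_scaled.
Qed.
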